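(* Let $K$ be a field and consider the subalgebra $R:=K[x^{4},x^{3}y,xy^{3},y^{4}]$ of the polynomial ring $K[x,y]$. Then the ideal $I:=(x^{4},x^{3}y)$ of $R$ is of height one and is Cohen-Macaulay as an $R$-module, while $R$ is not Cohen-Macaulay and not factorial.
   Context: $R$ is graded by the grading inherited from $K[x,y]$, with $R_0=K$; put $R_+=\bigoplus_{d\ge1}R_d$. For a finitely generated graded nonzero $R$-module $M$, a sequence of homogeneous elements $a_1,\dots,a_k\in R_+$ is $M$-regular if each $a_i$ is a nonzero divisor on $M/(a_1,\dots,a_{i-1})M$; $\operatorname{depth}(M)$ is the maximal length of an $M$-regular sequence in $R_+$, $\dim(M)$ is the Krull dimension of $R/\operatorname{Ann}_R(M)$, and $M$ is Cohen-Macaulay if $\operatorname{depth}(M)=\dim(M)$. The ring $R$ is Cohen-Macaulay if it is so as a module over itself. Factorial means unique factorization domain. *)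

(* Defs.v *)
(* MathComp, with multinomials for K[x,y]; boolp is used only to turn
   propositions into the boolean predicates that MathComp structures expect. *)
From HB Require Import structures.
From mathcomp Require Import all_boot all_order all_algebra ring_quotient.
From mathcomp Require Import mpoly.
From mathcomp Require Import boolp.

Set Implicit Arguments.
Unset Strict Implicit.
Unset Printing Implicit Defensive.

Import GRing.Theory.
Local Open Scope ring_scope.

(* Invariants are rendered as predicates: krull_dim A n, height J n, depth gr M n
   mean that the invariant exists, is finite, and equals n. *)
Definition is_max (P : nat -> Prop) (n : nat) : Prop :=
  P n /\ forall m, P m -> (m <= n)%N.

Definition is_min (P : nat -> Prop) (n : nat) : Prop :=
  P n /\ forall m, P m -> (n <= m)%N.

Section KrullDimension.
Variable A : comNzRingType.

(* P_0 < P_1 < ... < P_n: a chain of n + 1 primes, of length n. *)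
Definition prime_chain (n : nat) (P : 'I_n.+1 -> prime_idealr A) : Prop :=
  forall i j : 'I_n.+1, (i < j)%N ->
    {subset P i <= P j} /\ ~ {subset P j <= P i}.

Definition krull_dim : nat -> Prop :=
  is_max (fun n => exists P : 'I_n.+1 -> prime_idealr A, prime_chain P).

Definition prime_height (Q : prime_idealr A) : nat -> Prop :=
  is_max (fun n => exists P : 'I_n.+1 -> prime_idealr A,
            prime_chain P /\ P ord_max =i Q).

(* Primes of infinite height do not affect the minimum. *)
Definition height (J : {pred A}) : nat -> Prop :=
  is_min (fun h => exists Q : prime_idealr A,
            {subset J <= Q} /\ prime_height Q h).

End KrullDimension.

Section Factorial.
Variable A : idomainType.

Definition irreducible_elt (a : A) : Prop :=
  [/\ a != 0, a \isn't a GRing.unit &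
      forall b c, a = b * c -> b \is a GRing.unit \/ c \is a GRing.unit].

Definition associated (a b : A) : Prop :=
  exists2 u, u \is a GRing.unit & a = u * b.

Definition factorial_domain : Prop :=
  (forall a : A, a != 0 -> a \isn't a GRing.unit ->
     exists2 s : seq A,
       (forall p, p \in s -> irreducible_elt p) & a = \prod_(p <- s) p) /\
  (forall s t : seq A,
     (forall p, p \in s -> irreducible_elt p) ->
     (forall p, p \in t -> irreducible_elt p) ->
     \prod_(p <- s) p = \prod_(p <- t) p ->
     exists t' : seq A, [/\ perm_eq t t', size s = size t' &
       forall i, (i < size s)%N -> associated s`_i t'`_i]).

End Factorial.

Section Modules.
Variable A : comNzRingType.

Record nzModule := NzModule {
  nzmod_sort :> lmodType A;
  nzmod_neq0 : exists m : nzmod_sort, m != 0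
}.

(* (s_0, ..., s_(k-1)) M *)
Definition ideal_mul (M : lmodType A) (s : seq A) : {pred M} :=
  fun x => `[< exists m : 'I_(size s) -> M,
                 x = \sum_(j < size s) s`_j *: m j >].
Arguments ideal_mul : clear implicits.

(* The condition at i says that s_i is a nonzero divisor on
   M / (s_0, ..., s_(i-1)) M. *)
Definition regular_seq (M : lmodType A) (s : seq A) : Prop :=
  forall i, (i < size s)%N -> forall x : M,
    s`_i *: x \in ideal_mul M (take i s) -> x \in ideal_mul M (take i s).

(* gr d is the homogeneous component of degree d of A; a homogeneous element
   of the sum of the gr d over d > 0 is an element of one such gr d. *)
Definition depth (gr : nat -> {pred A}) (M : lmodType A) : nat -> Prop :=
  is_max (fun n => exists s : seq A, [/\ size s = n,
    (forall a, a \in s -> exists2 d, (0 < d)%N & a \in gr d) &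
    regular_seq M s]).

Definition ann (M : nzModule) : {pred A} :=
  fun a => `[< forall m : M, a *: m = 0 >].

Lemma ann_idealr_closed (M : nzModule) : idealr_closed (ann M).
Proof.
split.
- by apply/asboolP => m; rewrite scale0r.
- apply/negP => /asboolP h; have [m /negP[]] := nzmod_neq0 M.
  by rewrite -[m]scale1r h.
- move=> a u v /asboolP hu /asboolP hv; apply/asboolP => m.
  by rewrite scalerDl -scalerA hu hv scaler0 addr0.
Qed.

HB.instance Definition _ (M : nzModule) :=
  isIdealr.Build A (ann M) (ann_idealr_closed M).

Definition module_dim (M : nzModule) : nat -> Prop :=
  krull_dim {ideal_quot (ann M)}.

Definition cohen_macaulay (gr : nat -> {pred A}) (M : nzModule) : Prop :=
  exists n, depth gr M n /\ module_dim M n.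

Lemma regular_module_neq0 : exists a : A^o, a != 0.
Proof. by exists 1; rewrite oner_neq0. Qed.

Definition ring_module : nzModule := NzModule regular_module_neq0.

Definition ideal_gen (s : seq A) : {pred A^o} := ideal_mul A^o s.

Lemma mem_ideal_gen (s : seq A) a : a \in s -> a \in ideal_gen s.
Proof.
move=> sa; have si : (index a s < size s)%N by rewrite index_mem.
apply/asboolP; exists (fun j => (j == Ordinal si)%:R).
rewrite (bigD1 (Ordinal si)) //= big1 ?addr0 => [|j /negPf ->].
  by rewrite nth_index // eqxx /GRing.scale /= mulr1.
by rewrite scaler0.
Qed.

Lemma ideal_gen_submod_closed s : submod_closed (ideal_gen s).
Proof.
split.
  by apply/asboolP; exists (fun=> 0); rewrite big1 // => j _; rewrite scaler0.
move=> a u v /asboolP[m ->] /asboolP[m' ->]; apply/asboolP.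
exists (fun j => a *: m j + m' j).
rewrite scaler_sumr -big_split; apply: eq_bigr => j _ /=.
by rewrite scalerDr !scalerA mulrC.
Qed.

HB.instance Definition _ s :=
  GRing.isSubmodClosed.Build A A^o (ideal_gen s) (ideal_gen_submod_closed s).

Record ideal_type (s : seq A) := IdealElt {
  ideal_val :> A^o;
  ideal_valP : ideal_val \in ideal_gen s
}.

HB.instance Definition _ s := [isSub for @ideal_val s].
HB.instance Definition _ s := [Choice of ideal_type s by <:].
HB.instance Definition _ s :=
  [SubChoice_isSubLmodule of ideal_type s by <:].

Lemma ideal_type_neq0 (s : seq A) :
  has (predC1 0) s -> exists a : ideal_type s, a != 0.
Proof.
case/hasP => a sa a0; exists (IdealElt (mem_ideal_gen sa)).
by apply: contra a0 => /eqP/(congr1 val) /= ->.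
Qed.

Definition ideal_module (s : seq A) (s_neq0 : has (predC1 0) s) : nzModule :=
  NzModule (ideal_type_neq0 s_neq0).

End Modules.

Section PolynomialSubalgebra.
Variables (K : fieldType) (n k : nat) (t : n.-tuple {mpoly K[k]}).

(* K[t_0, ..., t_(n-1)]: values at t of polynomials in n variables. *)
Definition subalg : {pred {mpoly K[k]}} :=
  fun p => `[< exists q : {mpoly K[n]}, p = q \mPo t >].

Lemma subalg_divring_closed : divring_closed subalg.
Proof.
split.
- by apply/asboolP; exists 1; rewrite rmorph1.
- move=> _ _ /asboolP[p ->] /asboolP[q ->].
  by apply/asboolP; exists (p - q); rewrite rmorphB.
- move=> _ q /asboolP[p ->] tq; have [Uq|nUq] := boolP (q \is a GRing.unit).
    have [c _ Dq] : exists2 c, c \in GRing.unit & q = c%:MP.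
      by case/andP: Uq => /eqP Dq Uc; exists q@_0.
    apply/asboolP; exists (p * (c^-1)%:MP); rewrite rmorphM /= comp_mpolyC.
    congr (_ * _); rewrite Dq.
    have [->|c0] := eqVneq c 0; first by rewrite invr0 mpolyC0 invr0.
    by rewrite -(rmorphV _ (_ : c \is a GRing.unit)) ?unitfE.
  rewrite invr_out //; move/asboolP: tq => [r ->].
  by apply/asboolP; exists (p * r); rewrite rmorphM.
Qed.

HB.instance Definition _ :=
  GRing.isDivringClosed.Build {mpoly K[k]} subalg subalg_divring_closed.

Record subalg_type := SubalgElt {
  subalg_val :> {mpoly K[k]};
  subalg_valP : subalg_val \in subalg
}.

HB.instance Definition _ := [isSub for subalg_val].
HB.instance Definition _ := [Choice of subalg_type by <:].
HB.instance Definition _ := [SubChoice_isSubIntegralDomain of subalg_type by <:].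

Definition subalg_homog (d : nat) : {pred subalg_type} :=
  fun a => subalg_val a \is d.-homog.

Lemma subalg_genP i : tnth t i \in subalg.
Proof. by apply/asboolP; exists 'X_i; rewrite comp_mpolyXU -tnth_nth. Qed.

Definition subalg_gen (i : 'I_n) : subalg_type := SubalgElt (subalg_genP i).

End PolynomialSubalgebra.

Section MacaulayCurve.
Variable K : fieldType.

Let x : {mpoly K[2]} := 'X_0.
Let y : {mpoly K[2]} := 'X_1.

Definition quartic_gens : 4.-tuple {mpoly K[2]} :=
  [tuple x ^+ 4; x ^+ 3 * y; x * y ^+ 3; y ^+ 4].

Definition quartic_ring : idomainType := subalg_type quartic_gens.

Definition quartic_grading : nat -> {pred quartic_ring} :=
  @subalg_homog K 4 2 quartic_gens.

(* x^4 and x^3 y, as elements of quartic_ring. *)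
Definition I_gens : seq quartic_ring :=
  [:: subalg_gen quartic_gens 0; subalg_gen quartic_gens 1].

Lemma I_gens_neq0 : has (predC1 0) I_gens.
Proof.
apply/orP; left; apply/eqP => /(congr1 (@subalg_val _ _ _ _)) /eqP.
by rewrite /= (tnth_nth 0) /= expf_eq0 /= -msize_poly_eq0 msizeX.
Qed.

Definition I_module : nzModule quartic_ring := ideal_module I_gens_neq0.

End MacaulayCurve.

Arguments quartic_grading : clear implicits.

(* Main.v *)
Require Import Defs.
From HB Require Import structures.
From mathcomp Require Import all_boot all_order all_algebra ring_quotient.
From mathcomp Require Import generic_quotient mpoly boolp zify.

Set Implicit Arguments.
Unset Strict Implicit.
Unset Printing Implicit Defensive.

Import GRing.Theory.
Local Open Scope ring_scope.

(** A polynomial lies in R exactly when each of its monomials x^i y^j satisfies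
    4 | i + j and (i, j) <> (2, 2) (quarticP), and in I exactly when each
    satisfies 4 | i + j and 3 <= i (I_genP). So R is the fourth Veronese ring
    of K[x, y] with the single monomial x^2 y^2 removed, whereas I has no such
    gap. Everything is read off from these two exponent sets.

    Depth. Because I has no gap, x^4, y^4 is an I-regular sequence
    (I_module_regular). On R every regular sequence has length at most one
    (quartic_ring_regular_size): u = x^2 y^2 is not in R although a u is in R
    for every a of positive degree, so for a regular sequence a, b the relation
    b (a u) = a (b u) would put a u in a R, hence u in R.

    Upper bounds for dimension and depth. Both come from one elementary fact,
    in the style of Lombardi's characterisation of Krull dimension. Three
    elements a, b, c of R are algebraically dependent over K; factoring the
    lexicographically lowest monomial out of a dependence relation, with e a
    nonzero constant, gives
    a^i (b^j (c^k (e + r c) + r' b) + r'' a) = 0 with r, r', r'' in R.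
    Reading this identity modulo the members of a chain of primes, or modulo
    the successive submodules (s_0, ..., s_(i-1)) M of a regular sequence,
    excludes chains of length three, and regular sequences of length three on
    a module M that differs from (a, b, c) M (prime_chain_bound,
    regular_seq_bound). The dependence is a dimension count: there are N^3
    monomials with exponents below N in a, b, c, and they lie in a space of
    dimension O(N^2). So dim R = 2, witnessed by the primes 0, Q = R n (x) and
    R_+, and dim I = 2 since Ann I = 0. Thus I is Cohen-Macaulay and R is not.

    Height. I is contained in Q. Inverting y^4 makes Q principal, generated by
    x y^3; concretely y^8 q = (x y^3) r with r in R for each q in Q, where r
    has lower order in x than q. Descent on that order shows that a nonzero
    prime contained in Q equals Q (x_prime_minimal).

    Factoriality. R lives in degrees divisible by 4, so its elements of degree
    4 are irreducible, and x^4 y^4 = (x^3 y) (x y^3) has two essentially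
    different factorizations. *)

(** * Algebraic obstructions to long prime chains and regular sequences *)

Lemma is_max_unique P m n : is_max P m -> is_max P n -> m = n.
Proof. by move=> [Pm mP] [Pn nP]; apply/eqP; rewrite eqn_leq nP // mP. Qed.

Section IdealMul.
Variables (A : comNzRingType) (M : lmodType A).

Lemma ideal_mulP (s : seq A) (z : M) :
  reflect (exists f : nat -> M, z = \sum_(j < size s) s`_j *: f j)
          (z \in ideal_mul (M := M) s).
Proof.
apply: (iffP (asboolP _)) => [[f ->]|[f ->]]; last by exists (fun j => f j).
exists (fun j => oapp f 0 (insub j)).
by apply: eq_bigr => j _; rewrite valK.
Qed.

Lemma ideal_mul_nil (z : M) : (z \in ideal_mul (M := M) [::]) = (z == 0).
Proof.
apply/ideal_mulP/eqP => [[f ->]|->]; first by rewrite big_ord0.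
by exists (fun=> 0); rewrite big_ord0.
Qed.

Lemma ideal_mul_rcons (s : seq A) x (z w : M) :
  z \in ideal_mul (M := M) s -> z + x *: w \in ideal_mul (M := M) (rcons s x).
Proof.
case/ideal_mulP => f ->; apply/ideal_mulP.
exists (fun j => if (j < size s)%N then f j else w).
rewrite size_rcons big_ord_recr /= ltnn nth_rcons ltnn eqxx; congr (_ + _).
by apply: eq_bigr => j _; rewrite nth_rcons ltn_ord.
Qed.

Lemma ideal_mul_seq1 x (z : M) :
  reflect (exists w, z = x *: w) (z \in ideal_mul (M := M) [:: x]).
Proof.
apply: (iffP (ideal_mulP _ _)) => [[f]|[w]] ->; first by rewrite big_ord1; exists (f 0).
by exists (fun=> w); rewrite big_ord1.
Qed.

End IdealMul.

Section Collapse.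
Variable A : comNzRingType.
Implicit Types (s p : seq A) (v w r x : A).

(** The iterated boundaries of Lombardi: 0 belongs to collapse [:: a; b; c]
    when a^i (b^j (c^k (e + r c) + r' b) + r'' a) = 0 with e a unit. *)
Fixpoint collapse s v : Prop :=
  if s is x :: s' then
    exists k w r, collapse s' w /\ v = x ^+ k * (w + r * x)
  else exists w, w * v = 1.

Lemma prime_idealr_pow (P : prime_idealr A) x k v :
  x \notin P -> x ^+ k * v \in P -> v \in P.
Proof.
move=> xP; elim: k => [|k IHk]; first by rewrite mul1r.
by rewrite exprS -mulrA prime_idealrM (negPf xP).
Qed.

(** If v = x^k (w + r x) lies in P 0, which does not contain x, then w + r x
    does, and hence w lies in P 1, which contains x. After the last step a
    unit lies in a prime. *)
Lemma collapse_prime_chain s (P : nat -> prime_idealr A) v :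
    (forall i, (i < size s)%N ->
       [/\ {subset P i <= P i.+1}, s`_i \notin P i & s`_i \in P i.+1]) ->
  collapse s v -> v \notin P 0%N.
Proof.
elim: s P v => [|x s IHs] P v /= Ps.
  by case=> w wv; apply/negP => /(idealMr w); rewrite wv idealr1.
case=> k [w [r [sw ->]]]; apply/negP => vP.
have [P01 xP0 xP1] := Ps 0%N isT.
have /negP[] := IHs (P \o succn) w (fun i => Ps i.+1) sw.
have /P01 wrxP := prime_idealr_pow xP0 vP.
by rewrite -(addrK (r * x) w) /= rpredB // idealMr.
Qed.

Lemma prime_chain_bound n m (P : 'I_m.+1 -> prime_idealr A) :
    (forall s, (n < size s)%N -> collapse s 0) ->
  prime_chain P -> (m <= n)%N.
Proof.
move=> collapse0 chP; rewrite leqNgt; apply/negP => lt_nm.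
pose P' i := P (inord i).
pose step i x := [/\ {subset P' i <= P' i.+1}, x \notin P' i & x \in P' i.+1].
have ltP i : (i < m)%N -> exists x, step i x.
  move=> ltim; have [|sP nsP] := chP (inord i) (inord i.+1).
    by rewrite !inordK // ltnS ltnW.
  suff [x [xP nxP]] : exists x, x \in P' i.+1 /\ x \notin P' i by exists x.
  apply: contrapT => nx; apply: nsP => x xP; apply: contrapT => /negP nxP.
  by apply: nx; exists x.
pose x i := if pselect (exists x, step i x) is left e then projT1 (cid e) else 0.
have xP i : (i < m)%N -> step i (x i).
  by move=> /ltP; rewrite /x; case: pselect => // e _; case: (cid e).
have szx : size (mkseq x m) = m by rewrite size_mkseq.
have := @collapse_prime_chain (mkseq x m) P' 0.
rewrite szx => /(_ _ (collapse0 _ _))/negP[]; rewrite ?szx ?idealr0 //.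
by move=> i ltim; rewrite nth_mkseq //; apply: xP.
Qed.

Variable M : lmodType A.

Lemma regular_seq_pow p x s k (z : M) :
    regular_seq M (p ++ x :: s) ->
  x ^+ k *: z \in ideal_mul (M := M) p -> z \in ideal_mul (M := M) p.
Proof.
move=> reg; have lt_p : (size p < size (p ++ x :: s))%N.
  by rewrite size_cat /= addnS ltnS leq_addr.
elim: k => [|k IHk]; first by rewrite scale1r.
rewrite exprS -scalerA => xz; apply: IHk.
by have := reg _ lt_p (x ^+ k *: z); rewrite nth_cat ltnn subnn take_size_cat //; apply.
Qed.

(** The module form of the same descent: the prefix p is the part of the
    regular sequence already consumed. Regularity cancels x^k modulo p M, and
    r x z is absorbed when x joins the prefix; at the end a unit multiplies z
    into the submodule. *)
Lemma collapse_regular_seq p s v (z : M) :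
    regular_seq M (p ++ s) -> collapse s v ->
  v *: z \in ideal_mul (M := M) p -> z \in ideal_mul (M := M) (p ++ s).
Proof.
elim: s p v z => [|x s IHs] p v z reg /=.
  case=> w wv; rewrite cats0 => /ideal_mulP[f Df]; apply/ideal_mulP.
  exists (fun j => w *: f j).
  rewrite -[z]scale1r -wv -scalerA Df scaler_sumr; apply: eq_bigr => j _.
  by rewrite !scalerA mulrC.
case=> k [w [r [sw ->]]]; rewrite -scalerA => /(regular_seq_pow reg).
rewrite -cat_rcons in reg * => zp; apply: (IHs _ w) => //.
have -> : w *: z = (w + r * x) *: z + x *: (- r *: z).
  by rewrite scalerA -scalerDl mulrN [x * r]mulrC addrK.
exact: ideal_mul_rcons.
Qed.

Lemma regular_seq_bound n s (z : M) :
    (forall s', (n < size s')%N -> collapse s' 0) ->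
    regular_seq M s -> z \notin ideal_mul (M := M) s ->
  (size s <= n)%N.
Proof.
move=> collapse0 reg /negP nz; rewrite leqNgt; apply/negP => lt_ns; apply: nz.
apply: (@collapse_regular_seq [::] s 0) => //; first exact: collapse0.
by rewrite scale0r ideal_mul_nil.
Qed.

End Collapse.

(** * Algebraic dependence in subalgebras of polynomial rings *)

Lemma linear_kernel_neq0 (F : fieldType) m p (f : 'rV[F]_m -> 'rV[F]_p) :
  (forall a u v, f (a *: u + v) = a *: f u + f v) -> (p < m)%N ->
  exists2 v, v != 0 & f v = 0.
Proof.
move=> flin ltpm; pose fL := GRing.isLinear.Build _ _ _ _ f flin.
pose g : {linear 'rV[F]_m -> 'rV[F]_p} := HB.pack f fL.
have : kermx (lin1_mx g) != 0.
  rewrite -mxrank_eq0 mxrank_ker -lt0n subn_gt0.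
  exact: leq_ltn_trans (rank_leq_col _) ltpm.
case/rowV0Pn => v /sub_kermxP fv0 v_neq0; exists v => //.
by rewrite -fv0 mul_rV_lin1.
Qed.

Lemma msizeM_bound (K : fieldType) k (p q : {mpoly K[k]}) a b :
  (msize p <= a.+1)%N -> (msize q <= b.+1)%N -> (msize (p * q) <= (a + b).+1)%N.
Proof.
have [->|p0] := eqVneq p 0; first by rewrite mul0r msize0.
have [->|q0] := eqVneq q 0; first by rewrite mulr0 msize0.
rewrite msizeM // => pa qb; move: (leq_add pa qb).
by rewrite addSn addnS; case: (_ + _)%N.
Qed.

Section Dependence.
Variables (K : fieldType) (n k : nat) (t : n.-tuple {mpoly K[k]}).
Local Notation A := (subalg_type t).
Local Notation val := (@subalg_val K n k t).

Lemma subalgC c : c%:MP \in subalg t.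
Proof. by apply/asboolP; exists c%:MP; rewrite comp_mpolyC. Qed.

Definition subalg_const c : A := SubalgElt (subalgC c).

Lemma subalg_val_inj : injective val. Proof. exact: val_inj. Qed.

Lemma subalg_val_is_zmod_morphism : zmod_morphism val. Proof. by []. Qed.

Lemma subalg_val_is_monoid_morphism : monoid_morphism val. Proof. by []. Qed.

HB.instance Definition _ :=
  GRing.isZmodMorphism.Build A {mpoly K[k]} val subalg_val_is_zmod_morphism.
HB.instance Definition _ :=
  GRing.isMonoidMorphism.Build A {mpoly K[k]} val subalg_val_is_monoid_morphism.

(** The value at s of the polynomial with coefficient c l at the monomial of
    exponent l, all exponents being less than N. The sum is nested, as in a
    polynomial in x over polynomials in the other variables, so that recursion
    on s matches that of collapse. *)
Fixpoint box_eval (N : nat) (s : seq A) (c : seq nat -> K) : A :=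
  if s is x :: s' then
    \sum_(i < N) x ^+ i * box_eval N s' (fun l => c ((i : nat) :: l))
  else subalg_const (c [::]).

Section Box.
Variable N : nat.
Implicit Types (s : seq A) (c : seq nat -> K) (l : seq nat).

Lemma box_eval0 s c :
    (forall l, size l = size s -> all (gtn N) l -> c l = 0) ->
  box_eval N s c = 0.
Proof.
elim: s c => [|x s IHs] c c0 /=; first by apply: val_inj; rewrite /= c0.
rewrite big1 // => i _; rewrite IHs ?mulr0 // => l sz_l lN.
by apply: c0; rewrite /= ?sz_l // ltn_ord.
Qed.

(** Factor out the power x^i, for i the least exponent of x whose coefficient
    is not the zero polynomial, and treat that coefficient recursively. *)
Lemma box_eval_collapse s c l :
    size l = size s -> all (gtn N) l -> c l != 0 ->
  collapse s (box_eval N s c).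
Proof.
elim: s c l => [|x s IHs] c l /=.
  case: l => // _ _ c0; exists (subalg_const (c [::])^-1); apply: val_inj.
  by rewrite /= -mpolyCM mulVf // mpolyC1.
case: l => [|j l] // [sz_l] /= /andP[ltjN lN] cl.
pose nz i := `[< exists2 l, size l = size s /\ all (gtn N) l & c (i :: l) != 0 >].
have nz_ex : exists i, nz i by exists j; apply/asboolP; exists l.
case: (ex_minnP nz_ex) => i /asboolP[l' [sz_l' l'N] cl'] i_min.
have ltiN : (i < N)%N.
  by apply: leq_ltn_trans ltjN; apply: i_min; apply/asboolP; exists l.
have low0 h : (h < i)%N -> box_eval N s (fun l => c (h :: l)) = 0.
  move=> lthi; apply: box_eval0 => l1 sz1 l1N; apply: contraTeq lthi => c1.
  by rewrite -leqNgt; apply: i_min; apply/asboolP; exists l1.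
exists i, (box_eval N s (fun l => c (i :: l))).
exists (\sum_(i.+1 <= h < N) x ^+ (h - i.+1) * box_eval N s (fun l => c (h :: l))).
split; first exact: IHs sz_l' l'N cl'.
rewrite -(big_mkord xpredT (fun h => x ^+ h * box_eval N s (fun l => c (h :: l)))).
rewrite (big_cat_nat (n := i)) //=; last exact: ltnW.
rewrite big_nat_cond big1 ?add0r => [|h /andP[/andP[_ lthi] _]]; last first.
  by rewrite low0 ?mulr0.
rewrite big_ltn // mulrDr; congr (_ + _).
rewrite mulr_suml mulr_sumr big_nat_cond [RHS]big_nat_cond.
apply: eq_bigr => h /andP[/andP[ltih _] _].
have -> : x ^+ h = x ^+ i * (x ^+ (h - i.+1) * x).
  by rewrite -exprSr -exprD; congr (_ ^+ _); lia.
by rewrite -!mulrA; do 2!congr (_ * _); rewrite mulrC.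
Qed.

Lemma box_eval_linear s a c c' :
  val (box_eval N s (fun l => a * c l + c' l)) =
    a *: val (box_eval N s c) + val (box_eval N s c').
Proof.
suff -> : box_eval N s (fun l => a * c l + c' l) =
    subalg_const a * box_eval N s c + box_eval N s c' by rewrite /= mul_mpolyC.
elim: s c c' => [|x s IHs] c c' /=.
  by apply: val_inj; rewrite /= mpolyCD mpolyCM.
rewrite mulr_sumr -big_split; apply: eq_bigr => i _ /=.
by rewrite IHs mulrDr mulrCA.
Qed.

Lemma msize_box_eval D s c :
    (forall x, x \in s -> (msize (val x) <= D.+1)%N) ->
  (msize (val (box_eval N s c)) <= (size s * N * D).+1)%N.
Proof.
elim: s c => [|x s IHs] c sD /=; first by rewrite msizeC; case: eqP.
rewrite (rmorph_sum val) (leq_trans (msize_sum _ _ _)) //.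
apply/bigmax_leqP => i _; rewrite (rmorphM val) (rmorphXn val).
have -> : (((size s).+1 * N * D) = N * D + size s * N * D)%N by lia.
apply: msizeM_bound; last by apply: IHs => y ys; apply: sD; rewrite inE ys orbT.
have xD : (msize (val x) <= D.+1)%N by apply: sD; rewrite mem_head.
suff xiD : (msize (val x ^+ i) <= (i * D).+1)%N.
  by apply: leq_trans xiD _; rewrite ltnS leq_mul2r ltnW ?orbT.
elim: (i : nat) => [|j IHj]; first by rewrite expr0 msize1.
by rewrite exprS mulSn; apply: msizeM_bound.
Qed.

End Box.

(** More than k elements of a subalgebra of a polynomial ring in k variables
    are algebraically dependent. The box of exponents below N has N^(size s)
    points, while the values have all their exponents below
    b = size s * N * D + 1 <= E * N, hence live in dimension b^k. Taking
    N = E^k + 1 makes E^k N^k < N^(k+1) <= N^(size s), so evaluation has a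
    nonzero kernel. *)
Theorem subalg_collapse (s : seq A) : (k < size s)%N -> collapse s 0.
Proof.
move=> lt_ks; pose D := (\max_(x <- s) msize (val x))%N.
have sD x : x \in s -> (msize (val x) <= D.+1)%N.
  by move=> xs; apply: ltnW; apply: leq_bigmax_seq.
pose E := (size s * D).+1; pose N := (E ^ k).+1; pose b := (size s * N * D).+1.
pose T := ((size s).-tuple 'I_N : finType); pose U := ({ffun 'I_k -> 'I_b} : finType).
have ltUT : (#|U| < #|T|)%N.
  rewrite card_ffun card_tuple !card_ord.
  have leb : (b <= E * N)%N by rewrite /b /E; lia.
  have leNs : (N ^ k.+1 <= N ^ size s)%N by apply: leq_pexp2l.
  apply: leq_trans leNs; apply: (@leq_ltn_trans ((E * N) ^ k)).
    by case: k leb => // k' leb; rewrite leq_exp2r.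
  by rewrite expnMn expnS ltn_mul2r expn_gt0 /= ltnS.
pose c (v : 'rV[K]_#|T|) l := \sum_(u : T | map (@nat_of_ord N) u == l) v 0 (enum_rank u).
pose f v : 'rV[K]_#|U| := \row_j
  (val (box_eval N s (c v)))@_[multinom ((enum_val j : U) i : nat) | i < k].
have [a u v|v v_neq0 fv0] := @linear_kernel_neq0 K _ _ f _ ltUT.
  apply/rowP => j; rewrite !mxE.
  have -> : c (a *: u + v) = fun l => a * c u l + c v l.
    apply/funext => l; rewrite /c mulr_sumr -big_split.
    by apply: eq_bigr => w _; rewrite !mxE.
  by rewrite box_eval_linear mcoeffD mcoeffZ.
have <- : box_eval N s (c v) = 0.
  apply: val_inj; apply/mpolyP => m; rewrite mcoeff0; apply/eqP.
  rewrite mcoeff_eq0; apply/negP => vm.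
  have ltmb : (mdeg m < b)%N.
    exact: leq_trans (msize_mdeg_lt vm) (msize_box_eval _ _ sD).
  have mib i : (m i < b)%N.
    by apply: leq_ltn_trans ltmb; rewrite mdegE (bigD1 i) //= leq_addr.
  have /rowP/(_ (enum_rank [ffun i => Ordinal (mib i)])) := fv0.
  rewrite !mxE => /eqP; rewrite mcoeff_eq0 => /negP[].
  set m' := [multinom _ | i < k]; suff -> : m' = m by [].
  by apply/mnmP => i; rewrite mnmE enum_rankK ffunE.
have [j vj] : exists j, v 0 j != 0.
  by apply/existsP; apply: contraNT v_neq0; rewrite negb_exists => /forallP v0;
     apply/eqP/rowP => j; rewrite mxE; apply/eqP; have := v0 j; rewrite negbK.
apply: (@box_eval_collapse _ _ _ (map (@nat_of_ord N) (enum_val j : T))).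
- by rewrite size_map size_tuple.
- by apply/allP => _ /mapP[i _ ->] /=.
- rewrite /c (big_pred1 (enum_val j)) ?enum_valK // => u /=.
  by rewrite (inj_eq (inj_map (@ord_inj N))).
Qed.

End Dependence.

(** * Prime ideals under ring morphisms *)

Section ZeroPrime.
Variable B : idomainType.

Definition zero_ideal : {pred B} := fun b => b == 0.

Lemma zero_ideal_closed : idealr_closed zero_ideal.
Proof.
split; rewrite /in_mem /= /zero_ideal ?eqxx ?oner_eq0 //.
by move=> a u v /eqP-> /eqP->; rewrite mulr0 addr0.
Qed.

Lemma zero_ideal_prime : prime_idealr_closed zero_ideal.
Proof. by move=> u v; rewrite /in_mem /= /zero_ideal mulf_eq0. Qed.

HB.instance Definition _ := isIdealr.Build B zero_ideal zero_ideal_closed.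
HB.instance Definition _ := isPrimeIdealrClosed.Build B zero_ideal zero_ideal_prime.

Lemma nonzero_prime_chain (Q : prime_idealr B) b : b \in Q -> b != 0 ->
  exists P : 'I_2 -> prime_idealr B, prime_chain P /\ P ord_max =i Q.
Proof.
move=> bQ /negP b0.
exists (fun i => if nat_of_ord i is 0%N then zero_ideal : prime_idealr B else Q).
split=> // -[[|[|i]] ilt] [[|[|j]] jlt] //= _; split=> [a /eqP->|/(_ _ bQ)//].
exact: idealr0.
Qed.

End ZeroPrime.

Section PreimagePrime.
Variables (A B : comNzRingType) (f : {rmorphism A -> B}) (P : prime_idealr B).

Definition preim_ideal : {pred A} := fun a => f a \in P.

Lemma preim_ideal_closed : idealr_closed preim_ideal.
Proof.
split; rewrite /in_mem /= /preim_ideal ?rmorph0 ?rmorph1 ?idealr0 ?idealr1 //.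
by move=> a u v uP vP; rewrite rmorphD rmorphM rpredD ?idealMr.
Qed.

Lemma preim_ideal_prime : prime_idealr_closed preim_ideal.
Proof.
by move=> u v; rewrite /in_mem /= /preim_ideal rmorphM prime_idealrM.
Qed.

HB.instance Definition _ := isIdealr.Build A preim_ideal preim_ideal_closed.
HB.instance Definition _ := isPrimeIdealrClosed.Build A preim_ideal preim_ideal_prime.

Lemma mem_preim_ideal a : (a \in preim_ideal) = (f a \in P). Proof. by []. Qed.

End PreimagePrime.

Definition kernel_ideal (A : comNzRingType) (B : idomainType) (f : {rmorphism A -> B}) :
  prime_idealr A := preim_ideal f (@zero_ideal B).

Lemma mem_kernel_ideal (A : comNzRingType) (B : idomainType) (f : {rmorphism A -> B}) a :
  (a \in kernel_ideal f) = (f a == 0).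
Proof. by []. Qed.

(** Strict inclusions pull back to strict inclusions because f is onto. *)
Lemma prime_chain_preim (A B : comNzRingType) (f : {rmorphism A -> B}) g n
    (P : 'I_n.+1 -> prime_idealr B) :
  cancel g f -> prime_chain P ->
  prime_chain (fun i => preim_ideal f (P i) : prime_idealr A).
Proof.
move=> gK chP i j /chP[sP nsP]; split=> [a|sP']; first exact: sP.
by apply: nsP => b bPj; rewrite -[b]gK; apply: sP'; rewrite mem_preim_ideal gK.
Qed.

Lemma krull_dim_iso (A B : comNzRingType) (f : {rmorphism A -> B})
    (g : {rmorphism B -> A}) n :
  cancel f g -> cancel g f -> krull_dim A n -> krull_dim B n.
Proof.
move=> fK gK [[P chP] maxP]; split.
  exists (fun i => preim_ideal g (P i) : prime_idealr B).
  exact: prime_chain_preim fK chP.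
move=> m [Q chQ]; apply: maxP.
exists (fun i => preim_ideal f (Q i) : prime_idealr A).
exact: prime_chain_preim gK chQ.
Qed.

(** The quotient by a zero annihilator is isomorphic to A, the inverse of the
    projection being the choice of representatives. *)
Lemma module_dim_faithful (A : comNzRingType) (M : nzModule A) n :
  (forall a, a \in ann M -> a = 0) -> krull_dim A n -> module_dim M n.
Proof.
move=> ann0.
pose Q := {ideal_quot (ann M)}; pose pi : {rmorphism A -> Q} := \pi_Q%qT.
have piK : cancel pi (fun q : Q => repr q).
  move=> a; apply/eqP; rewrite -subr_eq0; apply/eqP/ann0.
  by rewrite Quotient.idealrBE reprK.
have reprKpi : cancel (fun q : Q => repr q) pi by move=> q; apply: reprK.
have pi_inj := can_inj piK.
have reprB : zmod_morphism (fun q : Q => repr q).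
  by move=> q r; apply: pi_inj; rewrite rmorphB /= !reprKpi.
have reprM : monoid_morphism (fun q : Q => repr q).
  by split=> [|q r]; apply: pi_inj; rewrite (rmorph1, rmorphM) /= !reprKpi.
pose addM := GRing.isZmodMorphism.Build Q A _ reprB.
pose mulM := GRing.isMonoidMorphism.Build Q A _ reprM.
pose g : {rmorphism Q -> A} := HB.pack (fun q : Q => repr q) addM mulM.
exact: (@krull_dim_iso _ _ pi g).
Qed.

(** * Supports of bivariate polynomials *)

Section Supports.
Variable K : fieldType.
Local Notation Kxy := {mpoly K[2]}.
Implicit Types (p q r : Kxy) (S : nat -> nat -> Prop).

Definition mexp (i j : nat) : 'X_{1..2} :=
  [multinom if val h == 0%N then i else j | h < 2].

Definition mono i j : Kxy := 'X_[mexp i j].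

Lemma mexpE (m : 'X_{1..2}) : m = mexp (m 0) (m 1).
Proof.
apply/mnmP; case=> [[|[]]] //= ?; rewrite mnmE; congr (m _); exact: val_inj.
Qed.

Lemma mexp0 i j : mexp i j 0 = i. Proof. by rewrite mnmE. Qed.

Lemma mexp1 i j : mexp i j 1 = j. Proof. by rewrite mnmE. Qed.

Lemma mexpD i j i' j' : (mexp i j + mexp i' j')%MM = mexp (i + i') (j + j').
Proof. by apply/mnmP => h; rewrite mnmDE !mnmE; case: ifP. Qed.

Lemma mdeg_mexp i j : mdeg (mexp i j) = (i + j)%N.
Proof.
rewrite mdegE !big_ord_recl big_ord0 addn0 mexp0 (_ : lift _ _ = 1) ?mexp1 //.
exact: val_inj.
Qed.

Lemma monoM i j i' j' : mono i j * mono i' j' = mono (i + i') (j + j').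
Proof. by rewrite -mpolyXD mexpD. Qed.

Lemma monoX i j e : mono i j ^+ e = mono (e * i) (e * j).
Proof.
elim: e => [|e IHe]; last by rewrite exprS IHe monoM !mulSn.
by rewrite expr0 /mono -mpolyX0; congr 'X_[_]; apply/mnmP => h; rewrite !mnmE if_same.
Qed.

Lemma monoE i j : 'X_0 ^+ i * 'X_1 ^+ j = mono i j.
Proof.
have X0 : 'X_0 = mono 1 0 by congr 'X_[_]; apply/mnmP; case=> [[|[]]] // ?; rewrite !mnmE.
have X1 : 'X_1 = mono 0 1 by congr 'X_[_]; apply/mnmP; case=> [[|[]]] // ?; rewrite !mnmE.
by rewrite X0 X1 !monoX monoM !(muln0, muln1, addn0).
Qed.

Lemma mono_neq0 i j : mono i j != 0.
Proof. by rewrite -msize_poly_eq0 msizeX. Qed.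

Definition supported S p := forall m, m \in msupp p -> S (m 0) (m 1).

Lemma supported_mono S i j : supported S (mono i j) <-> S i j.
Proof.
rewrite /supported msuppX; split=> [/(_ (mexp i j))|Sij m].
  by rewrite mem_head mexp0 mexp1; apply.
by rewrite inE => /eqP->; rewrite mexp0 mexp1.
Qed.

Lemma supported0 S : supported S 0.
Proof. by move=> m; rewrite msupp0. Qed.

Lemma supportedP S c p q : supported S p -> supported S q -> supported S (c *: p + q).
Proof.
move=> Sp Sq m /msuppD_le; rewrite mem_cat => /orP[/msuppZ_le|]; first exact: Sp.
exact: Sq.
Qed.

Lemma supportedD S p q : supported S p -> supported S q -> supported S (p + q).
Proof. by move=> Sp Sq; rewrite -[p]scale1r; apply: supportedP. Qed.

Lemma supportedM S1 S2 S p q :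
    (forall i j i' j', S1 i j -> S2 i' j' -> S (i + i')%N (j + j')%N) ->
  supported S1 p -> supported S2 q -> supported S (p * q).
Proof.
move=> S12 Sp Sq m /msuppM_le /allpairsP[[m1 m2] /= [m1p m2q ->]].
by rewrite !mnmDE; apply: S12; [apply: Sp | apply: Sq].
Qed.

Lemma supportedS S1 S p : (forall i j, S1 i j -> S i j) ->
  supported S1 p -> supported S p.
Proof. by move=> S1S Sp m /Sp/S1S. Qed.

Lemma supported_ind S (V : Kxy -> Prop) p :
    V 0 -> (forall c q r, V q -> V r -> V (c *: q + r)) ->
    (forall i j, S i j -> V (mono i j)) ->
  supported S p -> V p.
Proof.
move=> V0 VD VX Sp; rewrite [p]mpolyE big_seq.
elim/big_rec: _ => // m q mp Vq; apply: VD => //.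
by rewrite [m]mexpE; apply/VX/Sp.
Qed.

Lemma supported_div a b S S' p :
    (forall i j, S i j -> [/\ (a <= i)%N, (b <= j)%N & S' (i - a)%N (j - b)%N]) ->
  supported S p -> exists2 q, supported S' q & p = mono a b * q.
Proof.
move=> SS'; pose V p := exists2 q, supported S' q & p = mono a b * q.
apply: (@supported_ind _ V) => [|c _ _ [q Sq ->] [r Sr ->]|i j /SS'[ai bj Sij]].
- by exists 0; [apply: supported0 | rewrite mulr0].
- by exists (c *: q + r); [apply: supportedP | rewrite mulrDr scalerAr].
- exists (mono (i - a) (j - b)); first exact/supported_mono.
  by rewrite monoM !subnKC.
Qed.

Lemma msupp_monoM a b p m :
  ((mexp a b + m)%MM \in msupp (mono a b * p)) = (m \in msupp p).
Proof. by rewrite !mcoeff_msupp mulrC /mono mcoeffMX. Qed.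

End Supports.

(** * R and I as spans of monomials *)

Section IdealVal.
Variables (A : comNzRingType) (s : seq A).

Lemma ideal_valD (z w : ideal_type s) :
  ideal_val (z + w) = ideal_val z + ideal_val w.
Proof. exact: erefl. Qed.

Lemma ideal_val0 : ideal_val (0 : ideal_type s) = 0.
Proof. exact: erefl. Qed.

Lemma ideal_valZ a (z : ideal_type s) : ideal_val (a *: z) = a * ideal_val z.
Proof. exact: erefl. Qed.

End IdealVal.

Section Quartic.
Variable K : fieldType.
Local Notation Kxy := {mpoly K[2]}.
Local Notation R := (quartic_ring K).
Local Notation val := (@subalg_val K 4 2 (quartic_gens K)).
Local Notation mono := (mono K).
Local Notation gen h := (subalg_gen (quartic_gens K) h).

Definition quartic_exp i j : Prop := (4 %| i + j)%N /\ (i, j) <> (2%N, 2%N).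

Definition I_exp i j : Prop := (4 %| i + j)%N /\ (3 <= i)%N.

(** If a sum of exponents of R is (2, 2), the summands have total degree 0 and
    4, so one of them is already (2, 2). *)
Lemma quartic_expD i j i' j' :
  quartic_exp i j -> quartic_exp i' j' -> quartic_exp (i + i') (j + j').
Proof.
move=> [d ne] [d' ne']; split; first by rewrite addnACA dvdn_add.
case=> ei ej; have := (dvdnP d, dvdnP d') => -[[c Dc] [c' Dc']].
have [Ei|Ei] := eqVneq i 2%N; last have [Ei'|Ei'] := eqVneq i' 2%N; try by lia.
  by apply: ne; congr (_, _); lia.
by apply: ne'; congr (_, _); lia.
Qed.

Lemma quartic_gens_mono (h : 'I_4) :
  tnth (quartic_gens K) h = nth 0 [:: mono 4 0; mono 3 1; mono 1 3; mono 0 4] h.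
Proof.
rewrite (tnth_nth 0) /= -!monoE !expr0 !expr1 !mulr1 !mul1r.
by case: h => [[|[|[|[|]]]]].
Qed.

(** Divide i and j by 4. The remainders (3, 1) and (1, 3) are exponents of
    generators and (0, 0) needs none; for (2, 2) either i >= 4 or j >= 4, and
    the monomials of exponents (6, 2) and (2, 6) are the squares of x^3 y and
    x y^3. *)
Lemma quartic_exp_split i j : quartic_exp i j -> exists a b c d,
  (i, j) = (a * 4 + b * 3 + c * 1 + d * 0, a * 0 + b * 1 + c * 3 + d * 4)%N.
Proof.
move=> [/dvdnP[e De] ne].
pose a := (i %/ 4)%N; pose d := (j %/ 4)%N.
have [Ei|Ei] := eqVneq (i %% 4)%N 0%N.
  by exists a, 0%N, 0%N, d; congr (_, _); lia.
have [Ei1|Ei1] := eqVneq (i %% 4)%N 1%N.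
  by exists a, 0%N, 1%N, d; congr (_, _); lia.
have [Ei3|Ei3] := eqVneq (i %% 4)%N 3%N.
  by exists a, 1%N, 0%N, d; congr (_, _); lia.
have [a0|a1] := posnP a; last by exists a.-1, 2%N, 0%N, d; congr (_, _); lia.
exists 0%N, 0%N, 2%N, d.-1.
have [d0|d1] := posnP d; last by congr (_, _); lia.
by case: ne; congr (_, _); lia.
Qed.

Lemma quarticP (p : Kxy) : p \in subalg (quartic_gens K) <-> supported quartic_exp p.
Proof.
split=> [/asboolP[q ->]|].
  have S1 : supported quartic_exp (1 : Kxy).
    by move=> m; rewrite msupp1 inE => /eqP->; rewrite !mnmE.
  rewrite comp_mpolyE; elim/big_rec: _ => [|m r _]; first exact: supported0.
  apply: supportedP; elim/big_rec: _ => // h r' _.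
  apply: supportedM; first exact: quartic_expD.
  elim: (m h) => // e IHe; rewrite exprS.
  apply: supportedM IHe; first exact: quartic_expD.
  by rewrite quartic_gens_mono; case: h => [[|[|[|[|]]]]] //= _; apply/supported_mono.
pose V (q : Kxy) := q \in subalg (quartic_gens K).
apply: (@supported_ind K quartic_exp V) => [|c q r qR rR|i j].
- exact: rpred0.
- by rewrite /V -mul_mpolyC rpredD // rpredM // subalgC.
have memR (h : 'I_4) := subalg_genP (quartic_gens K) h.
case/quartic_exp_split => a [b [c [d [-> ->]]]].
rewrite /V -!monoM -!monoX !rpredM ?rpredX //.
- by have := memR 0; rewrite quartic_gens_mono.
- by have := memR 1; rewrite quartic_gens_mono.
- by have := memR 2%:R; rewrite quartic_gens_mono.
- by have := memR 3%:R; rewrite quartic_gens_mono.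
Qed.

Definition of_supported p (Sp : supported quartic_exp p) : R :=
  SubalgElt (proj2 (quarticP p) Sp).

Lemma quartic_supported (a : R) : supported quartic_exp (val a).
Proof. exact/quarticP/valP. Qed.

Lemma val_gen (h : 'I_4) : val (gen h) =
  nth 0 [:: mono 4 0; mono 3 1; mono 1 3; mono 0 4] h.
Proof. exact: quartic_gens_mono. Qed.

Lemma gen_neq0 (h : 'I_4) : gen h != 0.
Proof.
apply/eqP => /(congr1 val)/eqP; rewrite val_gen.
by case: h => [[|[|[|[|]]]]] //= _; rewrite (negPf (mono_neq0 _ _ _)).
Qed.

Lemma I_exp_quartic i j : I_exp i j -> quartic_exp i j.
Proof. by case=> d i3; split=> // -[Ei _]; rewrite Ei in i3. Qed.

(** A monomial of the right-hand side is divisible by x^4 with a quotient in R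
    unless i = 3 or (i, j) = (6, 2), where the quotient by x^4 would be
    y^j / x or x^2 y^2; in those cases x^3 y divides it within R. *)
Lemma I_genP (a : R) : a \in ideal_gen (I_gens K) <-> supported I_exp (val a).
Proof.
split=> [/ideal_mulP[f ->]|].
  rewrite !big_ord_recl big_ord0 addr0 rmorphD.
  apply: supportedD; rewrite rmorphM /= quartic_gens_mono.
    apply: (@supportedM _ (fun i j => (i, j) = (4, 0)%N) quartic_exp);
      last exact: quartic_supported.
      by move=> _ _ i' j' [-> ->] [d _]; split=> //; rewrite addnACA dvdn_add.
    exact/supported_mono.
  apply: (@supportedM _ (fun i j => (i, j) = (3, 1)%N) quartic_exp);
    last exact: quartic_supported.
    by move=> _ _ i' j' [-> ->] [d _]; split=> //; rewrite addnACA dvdn_add.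
  exact/supported_mono.
suff I_lift p : supported I_exp p ->
    exists2 b : R, b \in ideal_gen (I_gens K) & val b = p.
  by case/I_lift => b bI /val_inj <-.
pose V p := exists2 b : R, b \in ideal_gen (I_gens K) & val b = p.
apply: (@supported_ind _ _ V) => [|c _ _ [b bI <-] [b' b'I <-]|i j [d i3]].
- by exists 0; rewrite ?rpred0.
- exists (subalg_const (quartic_gens K) c * b + b'); last by rewrite /= mul_mpolyC.
  exact: (proj2 (ideal_gen_submod_closed (I_gens K)) (subalg_const (quartic_gens K) c)).
have [h [i' [j' [hI qe Dm]]]] : exists h i' j', [/\ gen h \in I_gens K,
    quartic_exp i' j' & val (gen h) * mono i' j' = mono i j].
  have [/andP[i4 ne]|] := boolP ((3 < i)%N && ((i, j) != (6, 2)%N)).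
    exists 0, (i - 4)%N, j; rewrite mem_head val_gen monoM; split=> //.
      split; first by lia.
      by case=> Ei Ej; move/eqP: ne; case; congr (_, _); lia.
    by congr mono; lia.
  move=> small; have [Ei Ej] : (i = 3 \/ i = 6 /\ j = 2)%N /\ (0 < j)%N.
    move: d small; have [->|i3'] := eqVneq i 3%N; first by case: j; split=> //; left.
    have -> /= : (3 < i)%N by lia.
    by rewrite negbK => _ /eqP[-> ->]; split=> //; right.
  exists 1, (i - 3)%N, (j - 1)%N; rewrite val_gen monoM !inE eqxx orbT; split=> //.
    by case: Ei => [Ei|[Ei Ej2]]; split; [lia | case; lia | lia | case; lia].
  by congr mono; lia.
exists (gen h * @of_supported (mono i' j') (proj2 (supported_mono _ _ _ _) qe)).
  rewrite mulrC -[_ * _]addr0.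
  apply: (proj2 (ideal_gen_submod_closed (I_gens K))); last exact: rpred0.
  exact: mem_ideal_gen.
exact: Dm.
Qed.

(** * Depth of I and of R *)

Lemma I_module_valD (z w : I_module K) :
  val (ideal_val (z + w)) = val (ideal_val z) + val (ideal_val w).
Proof. by rewrite ideal_valD (rmorphD val). Qed.

Lemma I_module_valZ (a : R) (z : I_module K) :
  val (ideal_val (a *: z)) = val a * val (ideal_val z).
Proof. by rewrite ideal_valZ (rmorphM val). Qed.

Lemma I_module_val0 : val (ideal_val (0 : I_module K)) = 0.
Proof. by rewrite ideal_val0 (rmorph0 val). Qed.

Lemma I_module_val_inj (z w : I_module K) :
  val (ideal_val z) = val (ideal_val w) -> z = w.
Proof. by move/val_inj/val_inj. Qed.

Lemma I_module_lift p : supported I_exp p ->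
  exists z : I_module K, val (ideal_val z) = p.
Proof.
move=> Ip; have Rp := supportedS I_exp_quartic Ip.
have Ib : of_supported Rp \in ideal_gen (I_gens K) by apply/I_genP.
by exists (IdealElt Ib).
Qed.

Lemma I_module_supported (z : I_module K) : supported I_exp (val (ideal_val z)).
Proof. exact/I_genP/ideal_valP. Qed.

(** If y^4 z = x^4 w with z and w in I, comparing exponents shows that every
    monomial of z has x-exponent at least 4 + 3, so z / x^4 is again in I. *)
Lemma I_module_regular : regular_seq (I_module K) [:: gen 0; gen 3%:R].
Proof.
case=> [|[|i]] //= _ z.
  rewrite !ideal_mul_nil => /eqP/(congr1 (fun z => val (ideal_val z)))/eqP.
  rewrite I_module_valZ I_module_val0 mulf_eq0 val_gen (negPf (mono_neq0 _ _ _)).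
  by move/eqP => z0; apply/eqP/I_module_val_inj; rewrite I_module_val0.
move/ideal_mul_seq1 => [w /(congr1 (fun z => val (ideal_val z)))].
rewrite !I_module_valZ !val_gen => Dz.
pose S i j := (4 %| i + j)%N /\ (7 <= i)%N.
have Sz : supported S (val (ideal_val z)).
  move=> m mz; split; first by case: (I_module_supported mz).
  have : (mexp 0 4 + m)%MM \in msupp (mono 4 0 * val (ideal_val w)).
    by rewrite -Dz msupp_monoM.
  case/msuppM_le/allpairsP => -[m1 m2] /= [].
  rewrite msuppX inE => /eqP-> /I_module_supported[_ i3].
  move/(congr1 (fun m : 'X_{1..2} => m 0)).
  by rewrite !mnmDE !mexp0; lia.
have [|q Iq Dq] := @supported_div _ 4 0 S I_exp _ _ Sz.
  move=> i j [d i7]; split=> //; first exact: leq_trans i7.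
  by split; lia.
have [w' Dw'] := I_module_lift Iq.
apply/ideal_mul_seq1; exists w'.
by apply/I_module_val_inj; rewrite I_module_valZ val_gen Dw'.
Qed.

Lemma homog_supported (a : R) d : (0 < d)%N -> a \in quartic_grading K d ->
  supported (fun i j => 0 < i + j)%N (val a).
Proof.
move=> d0 /dhomogP ad m /ad Dd; move: d0; rewrite -Dd /=.
by rewrite {1}[m]mexpE mdeg_mexp.
Qed.

(** Graded Nakayama for I: its elements have order at least 4, so s I lives in
    order at least 5 and misses x^4. *)
Lemma I_module_not_generated (s : seq R) :
    (forall a, a \in s -> exists2 d, (0 < d)%N & a \in quartic_grading K d) ->
  exists z : I_module K, z \notin ideal_mul s.
Proof.
move=> s_homog; have [|z Dz] := @I_module_lift (mono 4 0); first exact/supported_mono.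
exists z; apply/negP => /ideal_mulP[f Df].
suff : supported (fun i j => 4 < i + j)%N (mono 4 0) by move/supported_mono.
rewrite -Dz Df; elim/big_rec: _ => [|j p _ Sp]; first exact: supported0.
have [d d0 sd] := s_homog _ (mem_nth 0 (ltn_ord j)).
rewrite I_module_valD I_module_valZ; apply: supportedD Sp.
apply: supportedM (homog_supported d0 sd) (@I_module_supported (f j)).
by move=> i1 j1 i2 j2 ij [/dvdnP[c Dc]]; lia.
Qed.

Lemma quartic_collapse (s : seq R) : (2 < size s)%N -> collapse s 0.
Proof. exact: subalg_collapse. Qed.

Lemma I_module_depth : depth (quartic_grading K) (I_module K) 2.
Proof.
split.
  exists [:: gen 0; gen 3%:R]; split=> //; last exact: I_module_regular.
  move=> a; rewrite !inE => /orP[]/eqP->; exists 4%N => //.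
    by rewrite unfold_in /subalg_homog val_gen dhomogX /= mdeg_mexp.
  by rewrite unfold_in /subalg_homog val_gen dhomogX /= mdeg_mexp.
move=> m [s [<- s_homog s_reg]].
have [z] := I_module_not_generated s_homog.
exact: regular_seq_bound quartic_collapse s_reg.
Qed.

(** The obstruction is the class of x^2 y^2 in K[x, y] / R, which is killed by
    every homogeneous element of positive degree. *)
Lemma quartic_ring_regular_size (s : seq R) :
    (forall a, a \in s -> exists2 d, (0 < d)%N & a \in quartic_grading K d) ->
  regular_seq R^o s -> (size s <= 1)%N.
Proof.
case: s => [|a [|b s]] // s_homog s_reg.
have a0 : val a != 0.
  have := s_reg 0%N isT (1 : R^o); rewrite /= !ideal_mul_nil.
  rewrite (_ : a *: (1 : R^o) = a); last exact: mulr1.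
  move=> a_reg; apply/eqP => va0; have a0 : a = 0 by apply: val_inj.
  move: a_reg; rewrite a0 eqxx.
  by move=> /(_ isT); rewrite oner_eq0.
have mulu c : c \in a :: b :: s -> supported quartic_exp (val c * mono 2 2).
  move=> /s_homog[d d0 cd].
  pose S i j := quartic_exp i j /\ (0 < i + j)%N.
  apply: (@supportedM _ S (fun i j => (i, j) = (2, 2)%N)).
  - by move=> i j _ _ [[dv _] ij] [-> ->]; split; [lia | case; lia].
  - move=> m mc; split; first exact: quartic_supported mc.
    exact: (homog_supported d0 cd mc).
  - exact/supported_mono.
have au := mulu a (mem_head _ _).
have bu : supported quartic_exp (val b * mono 2 2).
  by apply: mulu; rewrite !inE eqxx orbT.
have : (of_supported au : R^o) \in ideal_mul [:: a].
  apply: (s_reg 1%N isT (of_supported au)); apply/ideal_mul_seq1.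
  by exists (of_supported bu); apply: val_inj; apply: mulrCA.
case/ideal_mul_seq1 => r /(congr1 val) /(mulfI a0) Dr.
have := @quartic_supported r; rewrite -Dr => /supported_mono[_].
by case.
Qed.

(** * Prime ideals of R and height of I *)

Definition at_x0 : {rmorphism Kxy -> Kxy} := comp_mpoly [tuple 0; 'X_1].

Lemma at_x0_mono i j : at_x0 (mono i j) = if i == 0%N then mono 0 j else 0.
Proof.
rewrite /= comp_mpolyX !big_ord_recl big_ord0 mulr1 !(tnth_nth 0) /= !mnmE /= expr0n.
by case: eqP => _; rewrite ?mul0r // mul1r -monoE expr0 mul1r.
Qed.

Lemma at_x0_eq0 p : at_x0 p = 0 <-> supported (fun i _ => 0 < i)%N p.
Proof.
split=> [p0 m mp|].
  have x0_coef q j : (at_x0 q)@_(mexp 0 j) = q@_(mexp 0 j).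
    pose V q := (at_x0 q)@_(mexp 0 j) = q@_(mexp 0 j).
    apply: (@supported_ind _ (fun _ _ => True) V) => //; rewrite /V.
    - by rewrite rmorph0.
    - move=> c q1 q2 Dq1 Dq2; rewrite -!mul_mpolyC rmorphD rmorphM /= comp_mpolyC.
      by rewrite !mcoeffD !mcoeffCM -Dq1 -Dq2.
    move=> i l _; rewrite at_x0_mono; case: eqP => [->//|i0].
    rewrite mcoeff0 mcoeffX; case: eqP => //.
    by move/(congr1 (fun m : 'X_{1..2} => m 0)); rewrite !mexp0.
  rewrite lt0n; apply/negP => /eqP m0; move: mp.
  by rewrite mcoeff_msupp {1}[m]mexpE m0 -x0_coef p0 mcoeff0 eqxx.
pose V p := at_x0 p = 0; apply: (@supported_ind _ _ V) => [|c q r q0 r0|i j].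
- exact: rmorph0.
- by rewrite /V -mul_mpolyC rmorphD rmorphM q0 r0 mulr0 addr0.
- by case: i => // i _; rewrite /V at_x0_mono.
Qed.

Definition x_prime : prime_idealr R := kernel_ideal (at_x0 \o val).

Lemma mem_x_prime (a : R) : a \in x_prime <-> supported (fun i _ => 0 < i)%N (val a).
Proof. by rewrite -at_x0_eq0 mem_kernel_ideal; split=> /eqP. Qed.

Definition irrelevant_prime : prime_idealr R := kernel_ideal (mcoeff 0%MM \o val).

Lemma mem_irrelevant (a : R) : (a \in irrelevant_prime) = ((val a)@_0%MM == 0).
Proof. by []. Qed.

(** The factor y^8, rather than y^4, keeps the quotient clear of the missing
    exponent: y^4 x^3 y / (x y^3) would be x^2 y^2. The second part records
    that r has lower order in x than a. *)
Lemma x_prime_mul (a : R) : a \in x_prime ->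
  exists2 r : R, mono 0 8 * val a = mono 1 3 * val r &
    forall i j, mexp i.+1 j \in msupp (val a) -> exists j', mexp i j' \in msupp (val r).
Proof.
move/mem_x_prime => a_x.
pose S i j := [/\ (4 %| i + j)%N, (0 < i)%N & (8 <= j)%N].
have Sa : supported S (mono 0 8 * val a).
  pose S' i j := quartic_exp i j /\ (0 < i)%N.
  apply: (@supportedM _ (fun i j => (i, j) = (0, 8)%N) S').
  - by move=> _ _ i j [-> ->] [[d _] i0]; split; lia.
  - exact/supported_mono.
  - by move=> m ma; split; [apply: (quartic_supported ma) | apply: (a_x m ma)].
have [|r Sr Dr] := @supported_div _ 1 3 S quartic_exp _ _ Sa.
  by move=> i j [d i0 j8]; split; [lia | lia | split; [lia | case; lia]].
exists (of_supported Sr) => // i j ma; exists (j + 5)%N.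
suff : mexp i (j + 5) \in msupp r by [].
rewrite -(msupp_monoM 1 3) -Dr mexpD (_ : mexp _ _ = (mexp 0 8 + mexp i.+1 j)%MM).
  by rewrite msupp_monoM.
by rewrite mexpD; congr mexp; lia.
Qed.

(** For a in P, the identity y^8 a = x y^3 r puts x y^3 or r in P; descending
    on the order in x, which is positive on P, gives x y^3 in P. The same
    identity then puts every q of x_prime in P, as y^4 is not in P. *)
Lemma x_prime_minimal (P : prime_idealr R) :
  (exists2 a : R, a \in P & a != 0) -> {subset P <= x_prime} -> {subset x_prime <= P}.
Proof.
move=> [a aP a0] Px.
have mul_y8 (b r : R) : mono 0 8 * val b = mono 1 3 * val r ->
    gen 3%:R ^+ 2 * b = gen 2%:R * r.
  move=> Dr; apply: subalg_val_inj.
  by rewrite (rmorphM val) (rmorphXn val) (rmorphM val) /= !quartic_gens_mono /= monoX.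
suff xy3P : gen 2%:R \in P.
  move=> q qx; have [r /mul_y8 Dr _] := x_prime_mul qx.
  have : gen 3%:R ^+ 2 * q \in P by rewrite Dr mulrC idealMr.
  apply: prime_idealr_pow; apply/negP => /Px/mem_x_prime.
  by rewrite val_gen => /supported_mono.
have [i [j mij]] : exists i j, mexp i j \in msupp (val a).
  by exists (mlead (val a) 0), (mlead (val a) 1); rewrite -mexpE mlead_supp.
elim: i j a {a0} aP mij => [|i IHi] j a aP mij.
  by have /mem_x_prime/(_ _ mij) := Px a aP; rewrite mexp0.
have [r /mul_y8 Dr /(_ _ _ mij)[j' mr]] := x_prime_mul (Px a aP).
have : gen 2%:R * r \in P by rewrite -Dr idealMr.
by rewrite prime_idealrM => /orP[//|rP]; apply: IHi mr.
Qed.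

Lemma x_prime_height : prime_height x_prime 1.
Proof.
split.
  apply: (@nonzero_prime_chain _ _ (gen 0)); last exact: gen_neq0.
  by apply/mem_x_prime; rewrite val_gen; apply/supported_mono.
move=> n [P [chP Pmax]]; rewrite leqNgt; apply/negP => n2.
have [|s01 ns01] := chP (inord (n - 2)) (inord (n - 1)); first by rewrite !inordK; lia.
have [|s12 ns12] := chP (inord (n - 1)) ord_max; first by rewrite !inordK /=; lia.
apply: ns12 => q; rewrite Pmax; apply: x_prime_minimal => [|a /s12]; last by rewrite Pmax.
apply: contrapT => nz; apply: ns01 => a aP.
have [->|a0] := eqVneq a 0; first exact: idealr0.
by case: nz; exists a.
Qed.

Lemma I_height : height (ideal_gen (I_gens K)) 1.
Proof.
split.
  exists x_prime; split; last exact: x_prime_height.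
  move=> a /I_genP Ia; apply/mem_x_prime.
  by apply: supportedS Ia => i j [_]; apply: leq_trans.
move=> h [Q [IQ [_ maxQ]]]; apply: maxQ.
apply: (@nonzero_prime_chain _ _ (gen 0)); last exact: gen_neq0.
by apply/IQ/mem_ideal_gen; rewrite mem_head.
Qed.

Lemma quartic_krull_dim : krull_dim R 2.
Proof.
split; last by move=> m [P]; apply: prime_chain_bound quartic_collapse.
pose P (i : 'I_3) : prime_idealr R :=
  match nat_of_ord i with 0 => @zero_ideal R | 1 => x_prime | _ => irrelevant_prime end.
exists P.
have zeroS (Q : prime_idealr R) : {subset (@zero_ideal R : pred R) <= Q}.
  by move=> a /eqP->; apply: idealr0.
have x4x : gen 0 \in x_prime by apply/mem_x_prime; rewrite val_gen; apply/supported_mono.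
have x4i : gen 0 \in irrelevant_prime.
  by rewrite mem_irrelevant val_gen mcoeffX -mdeg_eq0 mdeg_mexp.
have x4n0 : gen 0 \notin (@zero_ideal R : pred R).
  exact: gen_neq0.
move=> -[[|[|[|i]]] ilt] [[|[|[|j]]] jlt] //= _; split; try exact: zeroS.
- by move/(_ _ x4x); apply/negP.
- by move/(_ _ x4i); apply/negP.
- move=> a /mem_x_prime ax; rewrite mem_irrelevant mcoeff_eq0; apply/negP => /ax.
  by rewrite mnm0E.
- have y4i : gen 3%:R \in irrelevant_prime.
    by rewrite mem_irrelevant val_gen mcoeffX -mdeg_eq0 mdeg_mexp.
  by move/(_ _ y4i)/mem_x_prime; rewrite val_gen => /supported_mono.
Qed.

Lemma I_module_dim : module_dim (I_module K) 2.
Proof.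
apply: module_dim_faithful quartic_krull_dim => a /asboolP ann_a.
have [|z Dz] := @I_module_lift (mono 4 0); first exact/supported_mono.
have /(congr1 (fun z => val (ideal_val z)))/eqP := ann_a z.
rewrite I_module_valZ I_module_val0 Dz mulf_eq0 (negPf (mono_neq0 _ _ _)) orbF.
by move/eqP => va0; apply: val_inj.
Qed.

Lemma ring_module_dim : module_dim (ring_module R) 2.
Proof.
apply: module_dim_faithful quartic_krull_dim => a /asboolP /(_ (1 : R^o)).
by rewrite (_ : a *: (1 : R^o) = a) //; apply: mulr1.
Qed.

Lemma quartic_ring_not_cm : ~ cohen_macaulay (quartic_grading K) (ring_module R).
Proof.
move=> [n [[[s [sz s_homog s_reg]] _] dimn]].
have := quartic_ring_regular_size s_homog s_reg.
by rewrite sz (is_max_unique dimn ring_module_dim).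
Qed.

(** * Failure of unique factorization *)

Lemma quartic_const (b : R) : msize (val b) = 1%N -> b \is a GRing.unit.
Proof.
move/eqP/msize_poly1P => [c c0 Db].
apply/unitrP; exists (subalg_const _ c^-1).
by split; apply: val_inj; rewrite /= Db -mpolyCM ?mulVf ?mulfV ?mpolyC1.
Qed.

Lemma quartic_msize (b : R) : b != 0 -> exists e, msize (val b) = (4 * e).+1.
Proof.
move=> b0; have vb0 : val b != 0 by apply: contra b0 => /eqP vb; apply/eqP/val_inj.
rewrite -(mlead_deg vb0); have [/dvdnP[e De] _] := quartic_supported (mlead_supp vb0).
by exists e; rewrite [mlead _]mexpE mdeg_mexp De mulnC.
Qed.

(** The total degree, one less than msize, is a multiple of 4 on nonzero
    elements, so one factor of an element of degree 4 is constant. *)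
Lemma quartic_irreducible (a : R) : msize (val a) = 5%N -> irreducible_elt a.
Proof.
move=> sz_a; have a0 : a != 0.
  by apply/eqP => a0; move: sz_a; rewrite a0 (rmorph0 val) msize0.
split=> // [|b c Da].
  apply/negP => /unitrP[b [ba1 _]].
  have [e De] : exists e, msize (val b) = (4 * e).+1.
    apply: quartic_msize; apply/eqP => b0; move/eqP: ba1.
    by rewrite b0 mul0r eq_sym oner_eq0.
  have va0 : val a != 0 by rewrite -msize_poly_eq0 sz_a.
  have vb0 : val b != 0 by rewrite -msize_poly_eq0 De.
  have : msize (val b * val a) = 1%N by rewrite -(rmorphM val) ba1 (rmorph1 val) msize1.
  by rewrite msizeM // De sz_a; lia.
have [b0 c0] : b != 0 /\ c != 0 by apply/andP; rewrite -negb_or -mulf_eq0 -Da.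
have [[e De] [f Df]] := (quartic_msize b0, quartic_msize c0).
have vb0 : val b != 0 by rewrite -msize_poly_eq0 De.
have vc0 : val c != 0 by rewrite -msize_poly_eq0 Df.
have : msize (val a) = (msize (val b) + msize (val c)).-1.
  by rewrite Da (rmorphM val) msizeM.
rewrite sz_a De Df => ef; have [e0|f0] : e = 0%N \/ f = 0%N by lia.
  by left; apply: quartic_const; rewrite De e0.
by right; apply: quartic_const; rewrite Df f0.
Qed.

(** An associate of x^3 y or of x y^3 involves y in all its monomials, while
    x^4 does not, so no reordering matches x^4 with a factor of the other
    product. *)
Lemma quartic_ring_not_factorial : ~ factorial_domain R.
Proof.
case=> _ uniq_fact.
have gen_irr (h : 'I_4) : irreducible_elt (gen h).
  apply: quartic_irreducible; rewrite val_gen.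
  by case: h => [[|[|[|[|]]]]] //= _; rewrite msizeX mdeg_mexp.
have [|||t' [perm_t _ /(_ 0%N isT)[u _ /(congr1 val)]]] :=
  uniq_fact [:: gen 0; gen 3%:R] [:: gen 1; gen 2%:R].
- by move=> p; rewrite !inE => /orP[]/eqP->.
- by move=> p; rewrite !inE => /orP[]/eqP->.
- rewrite !big_cons !big_nil !mulr1; apply: val_inj.
  by rewrite /= !quartic_gens_mono /= !monoM.
rewrite (rmorphM val) /= quartic_gens_mono /= => Du.
have : t'`_0 \in [:: gen 1; gen 2%:R].
  by rewrite (perm_mem perm_t) mem_nth // -(perm_size perm_t).
have x4_supp : supported (fun i j => (0 < j)%N) (mono 4 0) -> False.
  by move/supported_mono.
rewrite !inE => /orP[]/eqP t'0; apply: x4_supp; rewrite Du t'0 val_gen;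
  apply: (@supportedM _ (fun _ _ => True) (fun i j => 0 < j)%N) => //;
  try exact/supported_mono; by move=> *; lia.
Qed.

End Quartic.

Theorem proposition7 (K : fieldType) :
  [/\ height (A := quartic_ring K) (ideal_gen (I_gens K)) 1,
      cohen_macaulay (quartic_grading K) (I_module K),
      ~ cohen_macaulay (quartic_grading K) (ring_module (quartic_ring K)) &
      ~ factorial_domain (quartic_ring K)].
Proof.
split.
- exact: I_height.
- by exists 2%N; split; [apply: I_module_depth | apply: I_module_dim].
- exact: quartic_ring_not_cm.
- exact: quartic_ring_not_factorial.
Qed.
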